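(* Consider the reactive delivery of a single video $V_i$ (length $L$, bitrate $r$, cached size $l_i$, request rate $\lambda_i$) under an arbitrary access pattern and the zero-delay constraint, as described in the context. Let CCE-MP (client caching enabled multicast patching) be the delivery mechanism with the following two operations: (a) the server multicasts every desired uncached part at the latest deadline, i.e. at the time of display; (b) each client starts buffering the desired uncached data from any ongoing multicast stream right after its request time. Then CCE-MP is an optimal multicast delivery mechanism: it satisfies the zero-delay constraint, and its average bandwidth consumption is less than or equal to that of every multicast delivery mechanism satisfying the zero-delay constraint.
   Context: Setting. A video $V_i$ is identified with the interval of positions $[0,L]$ (length measured in data units), and is displayed at rate $r>0$. Every client has pre-cached the same fixed (measurable) part $A\subseteq[0,L]$ of size $l_i\in[0,L]$. Requests for $V_i$ arrive at times $t_1<t_2<\cdots$ forming a Poisson process of rate $\lambda_i>0$. Request $j$ comes with a set $W_j\subseteq[0,L]$ of positions the client wants to watch and, for $x\in W_j$, the time $\tau_j(x)\in[t_j,t_j+L/r]$ at which position $x$ is displayed when playback starts at $t_j$ without any delay and proceeds at rate $r$ (e.g. for the full access pattern $W_j=[0,L]$ and $\tau_j(x)=t_j+x/r$). The rule producing $(W_j,\tau_j)$ is the access pattern; it is arbitrary. Multicast delivery mechanism. For each uncached position $x\in[0,L]\setminus A$ a mechanism specifies a locally finite set of times at which the (infinitesimal) portion at $x$ is multicast; every client that is listening at that time receives it, and clients may receive arbitrarily many streams simultaneously and buffer without limit, but only from their request time on. Zero-delay constraint: for every request $j$ and every $x\in W_j\setminus A$, the portion at $x$ is multicast at least once during $[t_j,\tau_j(x)]$.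 Average bandwidth consumption: if $S(t)=\int_{[0,L]\setminus A}N_x(t)\,dx$, where $N_x(t)$ is the number of transmissions of the portion at $x$ during $[0,t]$, the average bandwidth consumption is $\frac{1}{f_B}\limsup_{t\to\infty}S(t)/t$, where $f_B>0$ is the bandwidth efficiency. CCE-MP in these terms: the portion at $x\in[0,L]\setminus A$ is multicast at time $s$ if and only if there is a request $j$ with $x\in W_j$, $\tau_j(x)=s$, and no transmission of the portion at $x$ took place during $[t_j,s)$; each client listens to all transmissions of positions it wants from its request time on. *)

(* Defs.v *)
From HB Require Import structures.
From mathcomp Require Import all_boot all_order all_algebra.
From mathcomp Require Import all_classical all_reals all_analysis.

Set Implicit Arguments.
Unset Strict Implicit.
Unset Printing Implicit Defensive.

Import Order.TTheory GRing.Theory Num.Theory.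
Import numFieldNormedType.Exports.

Local Open Scope classical_set_scope.
Local Open Scope ring_scope.

(* [lebesgue_measure] lives on the Borel sets; these are the sets measurable for
   its completion. *)
Definition lebesgue_measurable (R : realType) (A : set R) : Prop :=
  (measurable_realfun.completed_algebra_gen
     (@lebesgue_measure R)).-sigma.-measurable A.

Definition arrivals (R : realType) (t : nat -> R) (a b : R) : set nat :=
  [set j | a < t j <= b].

(* Requests are numbered from 0: [t 0] is the first arrival.  The last clause
   says that the numbers of arrivals in consecutive intervals are independent
   and that the number in ]a, b] is Poisson of mean [lambda * (b - a)]. *)
Definition poisson_process d (T : measurableType d) (R : realType)
    (P : probability T R) (lambda : R) (t : nat -> {RV P >-> R}) : Prop :=
  [/\ forall w, 0 < t 0%N w,
      forall w j, t j w < t j.+1 w &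
      forall (n : nat) (u : nat -> R) (k : nat -> nat),
        0 <= u 0%N -> (forall i, (i < n)%N -> u i < u i.+1) ->
        P (\bigcap_(i < n)
             [set w | (arrivals (t ^~ w) (u i) (u i.+1) #= `I_(k i))%card])
        = (\prod_(i < n) poisson_pmf (lambda * (u i.+1 - u i)) (k i))%:E].

Section video.
Variables (R : realType) (L : R).
Implicit Types (A : set R) (t : nat -> R) (W : nat -> set R)
  (tau : nat -> R -> R) (x s : R).

(* One realization of the requests: request [j] arrives at [t j], wants the
   positions [W j], and displays [x \in W j] at time [tau j x]. *)
Definition access_pattern (r : R) t W tau : Prop :=
  forall j, W j `<=` `[0, L] /\
    (forall x, W j x -> t j <= tau j x <= t j + L / r).

Definition uncached A : set R := `[0, L] `\` A.

(* [multicast m x] is the set of times at which the portion at [x] is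
   multicast; [listen m j x] is the set of times at which the client of
   request [j] is listening for the portion at [x]. *)
Record mechanism := Mechanism {
  multicast : R -> set R;
  listen : nat -> R -> set R }.

Definition valid_mechanism A t (m : mechanism) : Prop :=
  (forall x, uncached A x ->
     forall a b : R, finite_set (multicast m x `&` `[a, b])) /\
  (forall j x s, listen m j x s -> t j <= s).

Definition zero_delay A t W tau (m : mechanism) : Prop :=
  forall j x, (W j `\` A) x ->
    multicast m x `&` `[t j, tau j x] !=set0.

Definition received_in_time A t W tau (m : mechanism) : Prop :=
  forall j x, (W j `\` A) x ->
    multicast m x `&` listen m j x `&` `[t j, tau j x] !=set0.

(* The first clause refers to the earlier transmissions of the mechanism
   itself, so this is a recursive specification of [multicast m x]. *)
Definition is_cce_mp A t W tau (m : mechanism) : Prop :=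
  (forall x, uncached A x -> forall s,
     multicast m x s <->
     exists j, [/\ W j x, tau j x = s &
                   multicast m x `&` `[t j, s[ = set0]) /\
  (forall j x s, listen m j x s <-> (W j `\` A) x /\ t j <= s).

Local Open Scope ereal_scope.

Definition transmissions (m : mechanism) (u : R) x : \bar R :=
  counting (multicast m x `&` `[0%R, u]).

(* No measurability in [x] is imposed: the integral of a nonnegative function
   is a supremum over the simple functions below it, hence always defined, and
   it is the Lebesgue integral when the integrand is measurable. *)
Definition transmitted A (m : mechanism) (u : R) : \bar R :=
  \int[completed_lebesgue_measure]_(x in uncached A) transmissions m u x.

Definition average_bandwidth (fB : R) A (m : mechanism) : \bar R :=
  (fB^-1)%:E *
  limf_esup (fun u : R => transmitted A m u * (u^-1)%:E) (pinfty_nbhs R).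

End video.

(* Main.v *)
(* Almost surely the arrivals are unbounded (the Poisson weights add up to 1),
   so that at each position only finitely many deadlines lie below a given time
   and the recursion defining CCE-MP is well founded.  If CCE-MP transmits x at
   time s, then it does so for a request j with deadline s, and it made no
   transmission of x from t_j on until s.  Hence the windows from t_j to s of
   distinct transmissions are disjoint, and a mechanism meeting the zero-delay
   constraint transmits x in each of them.  So by any time it has transmitted x
   at least as often as CCE-MP, and the bandwidths compare by monotonicity of
   the integral and of the limit superior. *)
Require Import Defs.
From HB Require Import structures.
From mathcomp Require Import all_boot all_order all_algebra.
From mathcomp Require Import all_classical all_reals all_analysis.

Set Implicit Arguments.
Unset Strict Implicit.
Unset Printing Implicit Defensive.

Import Order.TTheory GRing.Theory Num.Theory.
Import numFieldNormedType.Exports.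

Local Open Scope classical_set_scope.
Local Open Scope ring_scope.

(** * Almost sure unboundedness of Poisson arrivals *)

Lemma initial_segment_card_eq (A : set nat) (n : nat) :
  (forall i j, (i <= j)%N -> A j -> A i) -> (A #= `I_n)%card -> A = `I_n.
Proof.
move=> Adown An.
have Alt j : A j -> (j < n)%N.
  move=> Aj; rewrite -(@card_le_II j.+1 n).
  rewrite -(card_le_eqr An).
  by apply: subset_card_le => i /= ij; exact: Adown Aj.
apply/seteqP; split => j /= jn; first exact: Alt.
apply: contrapT => Aj; suff: (n <= j)%N by rewrite leqNgt jn.
rewrite -card_le_II -(card_le_eql An).
apply: subset_card_le => i Ai /=; rewrite ltnNge; apply/negP => ji.
exact/Aj/(Adown _ i).
Qed.

Definition unbounded (R : realType) (t : nat -> R) : Prop :=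
  forall u, exists j, u < t j.

Section poisson_arrivals.
Context d (T : measurableType d) (R : realType) (P : probability T R).
Variables (lambda : R) (t : nat -> {RV P >-> R}).
Hypotheses (lambda_gt0 : 0 < lambda) (t_poisson : poisson_process lambda t).

Let count_event (u : R) (k : nat) :=
  [set w | (arrivals (t ^~ w) 0 u #= `I_k)%card].

Let ler_arrival w : {homo (t ^~ w) : i j / (i <= j)%N >-> i <= j}.
Proof.
case: t_poisson => _ t_incr _.
by apply: homo_leq => [//|y x z|i]; [exact: le_trans|exact: ltW].
Qed.

Lemma arrival_gt0 w j : 0 < t j w.
Proof.
by case: t_poisson => t0 _ _; rewrite (lt_le_trans (t0 w))// ler_arrival.
Qed.

Let arrivals_down u w i j : (i <= j)%N ->
  arrivals (t ^~ w) 0 u j -> arrivals (t ^~ w) 0 u i.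
Proof.
move=> ij /andP[_ ju]; rewrite /arrivals /= arrival_gt0/=.
exact: le_trans (ler_arrival w ij) ju.
Qed.

(** Arrival times are positive and increasing, so the indices of arrivals up to [u] form an initial
    segment. Numbering starts at 0, so [k] is the first index past [u]. This form shows
    measurability and supplies an arrival beyond [u]. *)
Let count_eventE u k : count_event u k =
  [set w | u < t k w] `&` \bigcap_(j < k) [set w | t j w <= u].
Proof.
apply/seteqP; split => w /=.
  move=> /initial_segment_card_eq => /(_ (@arrivals_down u w)) arrE.
  have arrP j : arrivals (t ^~ w) 0 u j <-> `I_k j by rewrite arrE.
  split; last by move=> j /arrP/andP[].
  rewrite ltNge; apply/negP => tku.
  have /arrP : arrivals (t ^~ w) 0 u k by rewrite /arrivals /= arrival_gt0.
  by rewrite /= ltnn.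
move=> [utk tju]; rewrite /count_event /=.
have -> : arrivals (t ^~ w) 0 u = `I_k; last exact: card_eqxx.
apply/seteqP; split => j; rewrite /arrivals /=; last first.
  by move=> jk; rewrite arrival_gt0; exact: tju.
move=> /andP[_ ju]; rewrite ltnNge; apply/negP => kj.
by move: utk; rewrite ltNge (le_trans (ler_arrival w kj)).
Qed.

Let measurable_count_event u k : measurable (count_event u k).
Proof.
have mt j : measurable_fun setT (t j) by exact: measurable_funP.
rewrite count_eventE; apply: measurableI.
  rewrite -[X in measurable X]setTI.
  have -> : [set w | u < t k w] = t k @^-1` `]u, +oo[.
    by apply/seteqP; split => w /=; rewrite in_itv/= andbT.
  exact: mt.
apply: bigcap_measurableType => j _; rewrite -[X in measurable X]setTI.
have -> : [set w | t j w <= u] = t j @^-1` `]-oo, u].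
  by apply/seteqP; split => w /=; rewrite in_itv.
exact: mt.
Qed.

Let count_event_pmf u k : 0 < u ->
  P (count_event u k) = (poisson_pmf (lambda * u) k)%:E.
Proof.
move=> u_gt0; case: t_poisson => _ _ /(_ 1%N (fun i => i%:R * u) (fun=> k)).
rewrite big_ord1 mul0r mul1r subr0 => <- //; last first.
  by move=> i; rewrite ltnS leqn0 => /eqP ->; rewrite mul0r mul1r.
congr (P _); apply/seteqP; split => w /=.
  by move=> wk i /=; rewrite ltnS leqn0 => /eqP ->; rewrite mul0r mul1r.
by move=> /(_ 0%N); rewrite /= mul0r mul1r; exact.
Qed.

(** The count events are disjoint over [k] and their Poisson weights sum to 1. So the count is
    almost surely some finite [k], and arrival [k] then lies past [u]. *)
Let ae_arrival_gt u : 0 < u -> {ae P, forall w, exists j, u < t j w}.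
Proof.
move=> u_gt0; have mF : measurable (\bigcup_k count_event u k).
  exact: bigcup_measurable.
have tF : trivIset setT (count_event u).
  move=> i j _ _ [w [/card_esym wi wj]];
  exact/card_eq_II/(card_eq_trans wi wj).
have PF : P (\bigcup_k count_event u k) = 1%E.
  rewrite measure_semi_bigcup//.
  rewrite (eq_eseriesr (fun k _ => count_event_pmf k u_gt0)).
  rewrite nneseries_esumT => [|n]; last by rewrite lee_fin poisson_pmf_ge0.
  rewrite -(@probability_setT _ _ _ (poisson_prob (lambda * u) 0)).
  by rewrite /= /poisson_prob mulr_gt0.
exists (~` \bigcup_k count_event u k); split; first exact: measurableC.
  by rewrite probability_setC// PF subee.
move=> w /= wu [k _ wk]; apply: wu; exists k.
by move: wk; rewrite count_eventE => -[].
Qed.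

Lemma ae_arrivals_unbounded : {ae P, forall w, unbounded (t ^~ w)}.
Proof.
(* Countably many null sets are discarded, one for each level [n + 1]; the shift keeps the levels
   positive. *)
have := ae_foralln (fun n : nat => ae_arrival_gt (ltr0Sn R n)).
apply: filterS => w wN u; have [j nj] := wN (Num.bound `|u|).
exists j; apply: lt_trans nj; apply: le_lt_trans (ler_norm u) _.
by apply: lt_trans (archi_boundP (normr_ge0 u)) _; rewrite ltr_nat.
Qed.

End poisson_arrivals.

(** * The greedy rule at a single position *)

Section greedy.
Variables (R : realType) (t : nat -> R) (J : set nat) (dl : nat -> R).
Hypotheses (t_incr : forall j, t j < t j.+1) (t_unbounded : unbounded t).
Hypothesis dl_ge : forall j, J j -> t j <= dl j.

(** The first clause of [is_cce_mp] at one fixed position: [J] holds the requests wanting it and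
    [dl] their display times. *)
Definition greedy (M : set R) : Prop := forall s,
  M s <-> exists j, [/\ J j, dl j = s & M `&` `[t j, s[ = set0].

Let early_index b k : b < t k -> forall j, J j -> dl j <= b -> (j < k)%N.
Proof.
move=> btk j Jj djb; rewrite ltnNge; apply/negP => kj.
have t_mono : {homo t : i l / (i <= l)%N >-> i <= l}.
  by apply: homo_leq => [//|y x z|i]; [exact: le_trans|exact: ltW].
have : t k <= t j by exact: t_mono.
apply/negP; rewrite -ltNge; apply: le_lt_trans btk.
by apply: le_trans djb; exact: dl_ge.
Qed.

(** The order [<] on the reals is not well founded. Restricting the smaller element to deadlines
    repairs this and loses nothing, since greedy transmissions occur only at deadlines. *)
Let earlier_deadline (s' s : R) : Prop := s' < s /\ exists2 j, J j & dl j = s'.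

Let wf_earlier_deadline : well_founded earlier_deadline.
Proof.
move=> b; have [k btk] := t_unbounded b.
(* The measure is the number of indices below [k] with deadline before [s]. Deadlines up to [b] have
   index below [k], and passing from [s] to an earlier [dl j] drops at least [j] from the count. *)
suff acc n s : s <= b -> (\sum_(j < k) (dl j < s)%R < n)%N ->
    Acc earlier_deadline s by exact: acc (lexx b) (ltnSn _).
elim: n s => [|n IH] s sb; first by rewrite ltn0.
move=> sn; constructor => _ [/[swap] -[j Jj <-] ds].
have djb : dl j <= b := le_trans (ltW ds) sb.
apply: IH => //; rewrite -ltnS; apply: leq_trans sn; rewrite ltnS.
have jk := early_index btk Jj djb.
rewrite (bigD1 (Ordinal jk))//= [X in (_ < X)%N](bigD1 (Ordinal jk))//= ltxx ds.
rewrite add0n add1n ltnS; apply: leq_sum => i _.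
by case: (ltP (dl i) (dl j)) => // dij; rewrite (lt_trans dij ds).
Qed.

Lemma exists_greedy : exists M, greedy M.
Proof.
pose step s (rec : forall s', earlier_deadline s' s -> Prop) : Prop :=
  exists j, [/\ J j, dl j = s &
    forall s' (lt_s's : earlier_deadline s' s), t j <= s' -> ~ rec s' lt_s's].
pose M : set R := Fix wf_earlier_deadline (fun=> Prop) step.
have ME s : M s = step s (fun s' _ => M s').
  rewrite /M Fix_eq// => {}s f g fg; congr step.
  by apply: functional_extensionality_dep => s'; exact/funext/fg.
exists M => s; rewrite [X in X <-> _]ME; split => -[j [Jj djs nM]];
  exists j; split => //.
  (* The recursion looks only at earlier deadlines, but any [s'] in [M] is a deadline by [ME], so
     the whole window is covered. *)
  apply/seteqP; split => // s' [Ms' /=]; rewrite in_itv/= => /andP[ts' s's].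
  apply: (nM s') => //; split => //; move: Ms'; rewrite ME => -[i [Ji dis' _]].
  by exists i.
move=> s' [s's _] ts' Ms'; suff : set0 s' by [].
by rewrite -nM; split => //=; rewrite in_itv/= ts'.
Qed.

Variable M : set R.
Hypothesis M_greedy : greedy M.

Lemma greedy_finite a b : finite_set (M `&` `[a, b]).
Proof.
have [k btk] := t_unbounded b.
apply: (@sub_finite_set _ _ (dl @` `I_k)); last exact/finite_image/finite_II.
move=> s [/M_greedy[j [Jj <- _]] /=]; rewrite in_itv/= => /andP[_ djb].
by exists j => //; exact: early_index btk _ Jj djb.
Qed.

(** Either a transmission in the half-open window already serves [j], or there is none and the rule
    forces one at [dl j]. *)
Lemma greedy_serves j : J j -> M `&` `[t j, dl j] !=set0.
Proof.
move=> Jj; have [M0|/set0P[s [Ms /=]]] := eqVneq (M `&` `[t j, dl j[) set0.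
  exists (dl j); split; first by apply/M_greedy; exists j.
  by rewrite /= in_itv/= lexx andbT dl_ge.
rewrite in_itv/= => /andP[tjs sdj]; exists s; split => //=.
by rewrite in_itv/= tjs ltW.
Qed.

(* The windows [t j, dl j] behind two distinct greedy transmissions are
   disjoint, so each of them contains its own point of [N]. *)
Lemma greedy_card_le (N : set R) (u : R) :
  (forall j, 0 <= t j) ->
  (forall j, J j -> N `&` `[t j, dl j] !=set0) ->
  (M `&` `[0, u] #<= N `&` `[0, u])%card.
Proof.
move=> t_ge0 N_serves.
(* [f s] is a transmission of [N] in the window behind [s], hence later than every greedy
   transmission before [s]; this makes [f] strictly increasing on [M]. Outside [M] the value 0 is a
   dummy. *)
have /choice[f fP] : forall s, exists s', M s ->
    [/\ N s', 0 <= s', s' <= s & forall y, M y -> y < s -> y < s'].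
  move=> s; have [Ms|nMs] := pselect (M s); last by exists 0.
  have /M_greedy[j [Jj djs Mjs]] := Ms.
  have [s' [Ns' /=]] := N_serves j Jj; rewrite in_itv/= djs => /andP[tjs' s's].
  exists s' => _; split => //; first exact: le_trans tjs'.
  move=> y My ys; apply: lt_le_trans tjs'; rewrite ltNge; apply/negP => tjy.
  suff : set0 y by [].
  by rewrite -Mjs; split => //=; rewrite in_itv/= tjy.
have f_lt x y : M x -> M y -> x < y -> f x < f y.
  move=> Mx My xy; have [_ _ fx _] := fP x Mx; have [_ _ _ fy] := fP y My.
  exact: le_lt_trans fx (fy x Mx xy).
have f_inj : {in M `&` `[0, u] &, injective f}.
  move=> x y /set_mem[Mx _] /set_mem[My _] fxy.
  by have [xy|xy|//] := ltgtP x y; [move: (f_lt _ _ Mx My xy)|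
    move: (f_lt _ _ My Mx xy)]; rewrite fxy ltxx.
rewrite -(card_le_eql (inj_card_eq f_inj)).
apply: subset_card_le => _ [s [Ms /= su] <-].
move: su; rewrite in_itv/= => /andP[_ su].
have [Nfs fs0 fss _] := fP s Ms; split => //=.
by rewrite in_itv/= fs0 (le_trans fss).
Qed.

End greedy.

(** * Monotonicity of counting, integral and limit superior *)

Local Open Scope ereal_scope.

Lemma counting_ge0 (T : choiceType) (R : realType) (A : set T) :
  0 <= counting A :> \bar R.
Proof. by rewrite /counting; case: ifP => // _; rewrite lee_fin. Qed.

Lemma le_counting (T : choiceType) (R : realType) (A B : set T) :
  (A #<= B)%card -> counting A <= counting B :> \bar R.
Proof.
move=> AB; have [finB|infB] := pselect (finite_set B); last first.
  by rewrite [leRHS]/counting asboolF// leey.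
have finA := card_le_finite AB finB.
rewrite /counting !asboolT// lee_fin ler_nat.
have [n Bn] := (finite_setP B).1 finB.
by rewrite (card_fset_set Bn) geq_card_fset_set// -(card_le_eqr Bn).
Qed.

(* Unlike [ge0_le_integral], no measurability of the integrands. *)
Lemma ge0_le_integral_nonmeas d (T : measurableType d) (R : realType)
    (mu : {measure set T -> \bar R}) (D : set T) (f g : T -> \bar R) :
  (forall x, D x -> 0 <= f x) -> (forall x, D x -> f x <= g x) ->
  \int[mu]_(x in D) f x <= \int[mu]_(x in D) g x.
Proof.
move=> f0 fg; rewrite !ge0_integralE//; last first.
  by move=> x Dx; exact: le_trans (f0 x Dx) (fg x Dx).
apply: ereal_sup_le => _ [h /= hf <-]; exists h => // x.
apply: le_trans (hf x) _; rewrite /patch; case: ifPn => // /set_mem; exact: fg.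
Qed.

Lemma le_limf_esup (T : choiceType) (X : filteredType T) (R : realType)
    (f g : X -> \bar R) (F : set_system X) : Filter F ->
  (\forall x \near F, f x <= g x) -> limf_esup f F <= limf_esup g F.
Proof.
move=> FF fg; apply: le_ereal_inf_tmp => _ [V FV <-].
(* Cutting [V] down to where [f <= g] keeps it in the filter, and there [f] stays below the supremum
   of [g] over [V]. *)
apply: ge_ereal_inf; exists (ereal_sup (f @` (V `&` [set x | f x <= g x]))).
  by exists (V `&` [set x | f x <= g x]) => //; exact: filterI.
apply: ge_ereal_sup => _ [x [Vx fgx] <-]; apply: le_trans fgx _.
by apply: ereal_sup_ubound; exists x.
Qed.

Local Close Scope ereal_scope.

(** * CCE-MP along one realization of the requests *)

Section realization.
Variables (R : realType) (L r fB : R) (A : set R) (t : nat -> R).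
Variables (W : nat -> set R) (tau : nat -> R -> R).
Hypotheses (fB_gt0 : 0 < fB) (t_gt0 : forall j, 0 < t j).
Hypotheses (t_incr : forall j, t j < t j.+1) (t_unbounded : unbounded t).
Hypothesis pattern : access_pattern L r t W tau.

Let deadline_ge x j : [set j | W j x] j -> t j <= tau j x.
Proof. by move=> Wjx; have [_ /(_ x Wjx)/andP[]] := pattern j. Qed.

Let uncached_wanted j x : (W j `\` A) x -> uncached L A x.
Proof. by move=> [Wjx nAx]; split => //; have [+ _] := pattern j; exact. Qed.

(** The rule does not couple positions, so a greedy set is chosen separately for each [x]. *)
Lemma exists_cce_mp : exists m, is_cce_mp L A t W tau m.
Proof.
have /choice[M MP] : forall x, exists M, greedy t [set j | W j x] (tau ^~ x) M.
  by move=> x; exact: exists_greedy (@deadline_ge x).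
exists (Mechanism M (fun j x => [set s | (W j `\` A) x /\ t j <= s])).
by split => // x _; exact: MP.
Qed.

Variable m : mechanism R.
Hypothesis m_cce : is_cce_mp L A t W tau m.

Let m_greedy x : uncached L A x ->
  greedy t [set j | W j x] (tau ^~ x) (multicast m x).
Proof. by case: m_cce => + _; exact. Qed.

Lemma cce_mp_valid : valid_mechanism L A t m.
Proof.
split=> [x ux a b|j x s]; last by case: m_cce => _ /[apply] -[].
exact: greedy_finite (@deadline_ge x) _ (m_greedy ux) a b.
Qed.

Lemma cce_mp_zero_delay : zero_delay A t W tau m.
Proof.
move=> j x /[dup] -[Wjx _] /uncached_wanted ux.
exact: (greedy_serves (@deadline_ge x) (m_greedy ux) Wjx).
Qed.

Lemma cce_mp_received : received_in_time A t W tau m.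
Proof.
move=> j x wjx; have [s [ms sj]] := cce_mp_zero_delay wjx.
exists s; split => //; split => //; apply/m_cce.2; split => //.
by move: sj; rewrite /= in_itv/= => /andP[].
Qed.

Lemma cce_mp_optimal (m' : mechanism R) : zero_delay A t W tau m' ->
  (average_bandwidth L fB A m <= average_bandwidth L fB A m')%E.
Proof.
move=> m'_zero_delay; apply: lee_wpmul2l; first by rewrite lee_fin invr_ge0 ltW.
apply: le_limf_esup; near=> u.
(* Only large [u] matter, so the factor [u^-1] is nonnegative. *)
apply: lee_wpmul2r; first by rewrite lee_fin invr_ge0.
apply: ge0_le_integral_nonmeas => x ux; first exact: counting_ge0.
apply/le_counting/(greedy_card_le (m_greedy ux)) => [j|j Wjx]; first exact: ltW.
by apply: m'_zero_delay; split => //; case: ux.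
Unshelve. all: by end_near. Qed.

End realization.

(** * Almost sure existence and optimality *)

Theorem proposition1 (R : realType) (d : measure_display)
    (T : measurableType d) (P : probability T R)
    (L r l lambda fB : R) (A : set R)
    (t : nat -> {RV P >-> R})
    (W : T -> nat -> set R) (tau : T -> nat -> R -> R)
    (r_gt0 : 0 < r) (lambda_gt0 : 0 < lambda) (fB_gt0 : 0 < fB)
    (l_range : 0 <= l <= L)
    (A_sub : A `<=` `[0, L]) (A_meas : lebesgue_measurable A)
    (A_size : completed_lebesgue_measure A = l%:E)
    (t_poisson : poisson_process lambda t)
    (pattern : forall w, access_pattern L r (t ^~ w) (W w) (tau w)) :
  (exists C : T -> mechanism R,
     {ae P, forall w, is_cce_mp L A (t ^~ w) (W w) (tau w) (C w)}) /\
  (forall C : T -> mechanism R,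
     {ae P, forall w, is_cce_mp L A (t ^~ w) (W w) (tau w) (C w)} ->
     [/\ {ae P, forall w, valid_mechanism L A (t ^~ w) (C w)},
         {ae P, forall w, zero_delay A (t ^~ w) (W w) (tau w) (C w)},
         {ae P, forall w, received_in_time A (t ^~ w) (W w) (tau w) (C w)} &
         forall M : T -> mechanism R,
           {ae P, forall w, valid_mechanism L A (t ^~ w) (M w)} ->
           {ae P, forall w, zero_delay A (t ^~ w) (W w) (tau w) (M w)} ->
           {ae P, forall w, (average_bandwidth L fB A (C w)
                             <= average_bandwidth L fB A (M w))%E}]).
Proof.
have [_ t_incr _] := t_poisson.
have t_gt0 w j : 0 < t j w := arrival_gt0 t_poisson w j.
have t_unb := ae_arrivals_unbounded lambda_gt0 t_poisson.
split.
  have /choice[C C_cce] : forall w, exists m, unbounded (t ^~ w) ->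
      is_cce_mp L A (t ^~ w) (W w) (tau w) m.
    move=> w; have [wu|nwu] := pselect (unbounded (t ^~ w)).
      by have [m mP] := exists_cce_mp A (t_incr w) wu (pattern w); exists m.
    (* On the null event of bounded arrivals a silent mechanism serves as default. *)
    by exists (Mechanism (fun=> set0) (fun _ _ => set0)).
  by exists C; exact: filterS t_unb.
move=> C C_cce; split.
- apply: filterS2 t_unb C_cce => w wu.
  exact: (cce_mp_valid (t_incr w) wu (pattern w)).
- by apply: filterS C_cce => w; exact: (cce_mp_zero_delay (pattern w)).
- by apply: filterS C_cce => w; exact: (cce_mp_received (pattern w)).
- move=> M _ M_zero_delay; apply: filterS2 C_cce M_zero_delay => w wC.
  exact: (cce_mp_optimal fB_gt0 (t_gt0 w) wC).
Qed.
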